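(* Let $\mathit{rs}$ be a list of $K$ distinct splitting rules, let $\mathit{xs}$ be a data list, and let $E$ be an objective function defined by the recursive scheme $E(\mathit{DL}(\mathit{ys}))=f(\mathit{ys})$, $E(\mathit{DN}(u,r,v))=g\big(E(\mathit{mapD}_{\cap r^{+}}(u)),E(\mathit{mapD}_{\cap r^{-}}(v))\big)$ with $g(a,b)\ge\max(a,b)$, such that the following monotonicity property holds: for every rule $r$ and all trees $u,u',v,v'$, $$E(\mathit{mapD}_{\cap r^{+}}(u))\le E(\mathit{mapD}_{\cap r^{+}}(u'))\ \wedge\ E(\mathit{mapD}_{\cap r^{-}}(v))\le E(\mathit{mapD}_{\cap r^{-}}(v'))\ \Longrightarrow\ E(\mathit{DN}(u,r,v))\le E(\mathit{DN}(u',r,v')).$$ Define recursively $$\mathit{odt}_{\text{BF}}(\mathit{xs},[\,])=\mathit{DL}(\mathit{xs}),\qquad \mathit{odt}_{\text{BF}}(\mathit{xs},[r])=\mathit{DN}(\mathit{DL}(\mathit{xs}^{+}),r,\mathit{DL}(\mathit{xs}^{-})),$$ and, for $\mathit{rs}$ of length at least two, $$\mathit{odt}_{\text{BF}}(\mathit{xs},\mathit{rs})=\mathit{min}_{E}\big[\mathit{DN}(\mathit{odt}_{\text{BF}}(\mathit{xs}^{+},\mathit{rs}^{+}),r,\mathit{odt}_{\text{BF}}(\mathit{xs}^{-},\mathit{rs}^{-}))\mid r\leftarrow\mathit{rs},\ (\mathit{rs}^{+},\mathit{rs}^{-})\leftarrow\mathit{splits}_{\text{BF}}(\mathit{rs}/r)\big].$$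 Then $\mathit{odt}_{\text{BF}}(\mathit{xs},\mathit{rs})$ is a solution of $\mathit{min}_{E}(\mathit{genDTBFs}(\mathit{xs},\mathit{rs}))$; that is, $\mathit{odt}_{\text{BF}}(\mathit{xs},\mathit{rs})$ is an element of the list $\mathit{genDTBFs}(\mathit{xs},\mathit{rs})$ attaining the minimum value of $E$ over it.
   Context: This is the decision tree problem over binary feature data: data points are vectors of $D$ binary features, and each rule asks whether a point has a given feature; only the fact that a rule $r$ splits the data space into two disjoint complementary regions $r^{+},r^{-}$ is used. A data list is a finite list of data points. Trees: $\mathit{DTree}$ is the inductive type of binary trees that are either a leaf $\mathit{DL}(\mathit{ys})$ carrying a data list $\mathit{ys}$, or a node $\mathit{DN}(u,r,v)$ with left subtree $u$, rule $r$, right subtree $v$. For a data list $\mathit{ys}$ and a region $S$ (or a list $S$), $\mathit{ys}\cap S$ is the sublist of elements of $\mathit{ys}$ lying in $S$. For the rule $r$ bound in the same expression, $\mathit{xs}^{\pm}=\mathit{xs}\cap r^{\pm}$. $\mathit{mapD}_{\cap S}$ replaces the data list $\mathit{ys}$ in every leaf of a tree by $\mathit{ys}\cap S$, leaving rules and shape unchanged. $\mathit{rs}/r$ is the list $\mathit{rs}$ with $r$ removed. $\mathit{splits}_{\text{BF}}(\mathit{rs})$ is the list of all $2^{|\mathit{rs}|}$ pairs $(\mathit{ss},\mathit{rs}/\mathit{ss})$ consisting of a sublist $\mathit{ss}$ of $\mathit{rs}$ and its complementary sublist. The generator is: $\mathit{genDTBFs}(\mathit{xs},[\,])=[\mathit{DL}(\mathit{xs})]$,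 $\mathit{genDTBFs}(\mathit{xs},[r])=[\mathit{DN}(\mathit{DL}(\mathit{xs}^{+}),r,\mathit{DL}(\mathit{xs}^{-}))]$, and otherwise $\mathit{genDTBFs}(\mathit{xs},\mathit{rs})$ is the list of all $\mathit{DN}(\mathit{mapD}_{\cap\mathit{xs}^{+}}(u),r,\mathit{mapD}_{\cap\mathit{xs}^{-}}(v))$ with $r$ from $\mathit{rs}$, $(\mathit{rs}^{+},\mathit{rs}^{-})$ from $\mathit{splits}_{\text{BF}}(\mathit{rs}/r)$, $u$ from $\mathit{genDTBFs}(\mathit{xs},\mathit{rs}^{+})$, $v$ from $\mathit{genDTBFs}(\mathit{xs},\mathit{rs}^{-})$. In the objective, $f$ maps data lists to $\mathbb{R}$ and $g:\mathbb{R}\times\mathbb{R}\to\mathbb{R}$. $\mathit{min}_{E}$ of a nonempty list of trees returns an element of smallest $E$-value: $\mathit{min}_E([a])=a$ and $\mathit{min}_E(a:\mathit{as})=a$ if $E(a)\le E(\mathit{min}_E(\mathit{as}))$, else $\mathit{min}_E(\mathit{as})$. *)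

(* Defs.v *)
From HB Require Import structures.
From mathcomp Require Import all_boot all_order all_algebra.
From mathcomp Require Import reals.
Set Implicit Arguments. Unset Strict Implicit. Unset Printing Implicit Defensive.
Import Order.TTheory GRing.Theory Num.Theory.

Definition point (D : nat) := D.-tuple bool.
Definition data (D : nat) := seq (point D).
Definition rule (D : nat) := 'I_D.

Definition posr D (r : rule D) : {pred point D} := [pred x : point D | tnth x r].
Definition negr D (r : rule D) : {pred point D} := [pred x : point D | ~~ tnth x r].

(* The intersection with a list S is [inter (mem S)]; it keeps the order and
   the multiplicities of the first list. *)
Definition inter D (S : {pred point D}) (ys : data D) : data D :=
  [seq x <- ys | x \in S].

Inductive DTree (D : nat) : Type :=
| DL of data D
| DN of DTree D & rule D & DTree D.

Lemma DTree_comparable D : comparable (DTree D).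
Proof. by move=> s t; rewrite /decidable; decide equality; apply: eq_comparable. Qed.

HB.instance Definition _ D :=
  hasDecEq.Build (DTree D) (compareP (@DTree_comparable D)).

Fixpoint mapD D (S : {pred point D}) (t : DTree D) : DTree D :=
  match t with
  | DL ys => DL (inter S ys)
  | DN u r v => DN (mapD S u) r (mapD S v)
  end.

Fixpoint splitsBF (T : Type) (rs : seq T) : seq (seq T * seq T) :=
  if rs is r :: rs' then
    [seq (r :: p.1, p.2) | p <- splitsBF rs'] ++
    [seq (p.1, r :: p.2) | p <- splitsBF rs']
  else [:: ([::], [::])].

Lemma size_splitsBF (T : Type) (rs : seq T) : size (splitsBF rs) = 2 ^ size rs.
Proof.
by elim: rs => //= r rs IH; rewrite size_cat !size_map IH addnn -mul2n expnS.
Qed.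

Lemma splitsBFP (T : eqType) (rs : seq T) (p : seq T * seq T) :
  reflect (exists2 m, size m = size rs & p = (mask m rs, mask (map negb m) rs))
          (p \in splitsBF rs).
Proof.
apply: (iffP idP).
- elim: rs p => [|r rs IH] p /=; first by rewrite inE => /eqP ->; exists [::].
  rewrite mem_cat => /orP[] /mapP[q /IH[m sm ->] ->].
    by exists (true :: m) => //=; rewrite sm.
  by exists (false :: m) => //=; rewrite sm.
- case=> m sm ->; elim: rs m sm => [|r rs IH] [|b m] // [/IH H].
  rewrite /= mem_cat; apply/orP.
  by case: b; [left | right]; apply/mapP; eexists; try exact: H.
Qed.

Lemma size_splitsBF_mem (T : eqType) (rs : seq T) (p : seq T * seq T) :
  p \in splitsBF rs -> size p.1 <= size rs /\ size p.2 <= size rs.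
Proof.
case/splitsBFP=> m sm -> /=.
rewrite !size_mask ?size_map // -sm; split; first exact: count_size.
by rewrite -[leqRHS](size_map negb) count_size.
Qed.

(* The recursion is on the length of [rs], passed as the bound [n]; the
   unbounded recursive equations are proved after each function. *)
Fixpoint genDTBFs_rec D (n : nat) (xs : data D) (rs : seq (rule D)) :
    seq (DTree D) :=
  match n, rs with
  | 0, _ | _, [::] => [:: DL xs]
  | _, [:: r] => [:: DN (DL (inter (posr r) xs)) r (DL (inter (negr r) xs))]
  | n'.+1, _ =>
    flatten [seq
      flatten [seq
        [seq DN (mapD (mem (inter (posr r) xs)) u) r
                (mapD (mem (inter (negr r) xs)) v)
           | u <- genDTBFs_rec n' xs p.1, v <- genDTBFs_rec n' xs p.2]
        | p <- splitsBF (rem r rs)]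
      | r <- rs]
  end.

Definition genDTBFs D (xs : data D) (rs : seq (rule D)) : seq (DTree D) :=
  genDTBFs_rec (size rs) xs rs.

Lemma size_split_rem D n (r : rule D) rs p : size rs <= n.+1 -> r \in rs ->
  p \in splitsBF (rem r rs) -> size p.1 <= n /\ size p.2 <= n.
Proof.
move=> le_n r_rs /size_splitsBF_mem; rewrite size_rem // => -[le1 le2].
have le_p : (size rs).-1 <= n by case: (size rs) le_n.
by split; [exact: leq_trans le1 le_p | exact: leq_trans le2 le_p].
Qed.

Lemma genDTBFs_recS D n (xs : data D) rs : 1 < size rs ->
  genDTBFs_rec n.+1 xs rs =
  flatten [seq
    flatten [seq
      [seq DN (mapD (mem (inter (posr r) xs)) u) r
              (mapD (mem (inter (negr r) xs)) v)
         | u <- genDTBFs_rec n xs p.1, v <- genDTBFs_rec n xs p.2]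
      | p <- splitsBF (rem r rs)]
    | r <- rs].
Proof. by case: rs => [|r [|r' rs]]. Qed.

Lemma genDTBFs_recE D n (xs : data D) rs :
  size rs <= n -> genDTBFs_rec n xs rs = genDTBFs xs rs.
Proof.
rewrite /genDTBFs; move: {2 4}(size rs) (leqnn (size rs)) => m.
elim: n m xs rs => [|n IH] [|m] xs [|r [|r' rs]] // le_m le_n.
rewrite !genDTBFs_recS //; congr flatten; apply/eq_in_map => s s_rs.
congr flatten; apply/eq_in_map => p p_s.
have [m1 m2] := size_split_rem le_m s_rs p_s.
have [n1 n2] := size_split_rem le_n s_rs p_s.
by rewrite !(IH m).
Qed.

Lemma genDTBFs0 D (xs : data D) : genDTBFs xs [::] = [:: DL xs].
Proof. by []. Qed.

Lemma genDTBFs1 D (xs : data D) (r : rule D) : genDTBFs xs [:: r] =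
  [:: DN (DL (inter (posr r) xs)) r (DL (inter (negr r) xs))].
Proof. by []. Qed.

Lemma genDTBFsE D (xs : data D) (rs : seq (rule D)) : 1 < size rs ->
  genDTBFs xs rs =
  flatten [seq
    flatten [seq
      [seq DN (mapD (mem (inter (posr r) xs)) u) r
              (mapD (mem (inter (negr r) xs)) v)
         | u <- genDTBFs xs p.1, v <- genDTBFs xs p.2]
      | p <- splitsBF (rem r rs)]
    | r <- rs].
Proof.
move=> gt1; rewrite -(genDTBFs_recE xs (leqnSn _)) genDTBFs_recS //; congr flatten; apply/eq_in_map => s s_rs.
congr flatten; apply/eq_in_map => p p_s.
have [n1 n2] := size_split_rem (leqnSn _) s_rs p_s.
by rewrite !genDTBFs_recE.
Qed.

Section Objective.
Local Open Scope ring_scope.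

(* [d] is only returned on the empty list. *)
Fixpoint minE (R : realType) (T : Type) (E : T -> R) (d : T) (s : seq T) : T :=
  match s with
  | [::] => d
  | [:: a] => a
  | a :: s' => let b := minE E d s' in if E a <= E b then a else b
  end.

Fixpoint odtBF_rec (R : realType) D (E : DTree D -> R) (n : nat)
    (xs : data D) (rs : seq (rule D)) : DTree D :=
  match n, rs with
  | 0%N, _ | _, [::] => DL xs
  | _, [:: r] => DN (DL (inter (posr r) xs)) r (DL (inter (negr r) xs))
  | n'.+1, _ =>
    minE E (DL xs)
      [seq DN (odtBF_rec E n' (inter (posr r) xs) p.1) r
              (odtBF_rec E n' (inter (negr r) xs) p.2)
         | r <- rs, p <- splitsBF (rem r rs)]
  end.

Definition odtBF (R : realType) D (E : DTree D -> R) (xs : data D)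
    (rs : seq (rule D)) : DTree D :=
  odtBF_rec E (size rs) xs rs.

Lemma odtBF_recS (R : realType) D (E : DTree D -> R) n (xs : data D) rs :
  (1 < size rs)%N ->
  odtBF_rec E n.+1 xs rs =
  minE E (DL xs)
    [seq DN (odtBF_rec E n (inter (posr r) xs) p.1) r
            (odtBF_rec E n (inter (negr r) xs) p.2)
       | r <- rs, p <- splitsBF (rem r rs)].
Proof. by case: rs => [|r [|r' rs]]. Qed.

Lemma odtBF_recE (R : realType) D (E : DTree D -> R) n (xs : data D) rs :
  (size rs <= n)%N -> odtBF_rec E n xs rs = odtBF E xs rs.
Proof.
rewrite /odtBF; move: {2 4}(size rs) (leqnn (size rs)) => m.
elim: n m xs rs => [|n IH] [|m] xs [|r [|r' rs]] // le_m le_n.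
rewrite !odtBF_recS //; congr minE.
apply: (congr1 flatten); apply/eq_in_map => s s_rs; apply/eq_in_map => p p_s.
have [m1 m2] := size_split_rem le_m s_rs p_s.
have [n1 n2] := size_split_rem le_n s_rs p_s.
by rewrite !(IH m).
Qed.

Lemma odtBF0 (R : realType) D (E : DTree D -> R) (xs : data D) :
  odtBF E xs [::] = DL xs.
Proof. by []. Qed.

Lemma odtBF1 (R : realType) D (E : DTree D -> R) (xs : data D) (r : rule D) :
  odtBF E xs [:: r] = DN (DL (inter (posr r) xs)) r (DL (inter (negr r) xs)).
Proof. by []. Qed.

(* The list of candidates is never empty, so the default is arbitrary. *)
Lemma odtBFE (R : realType) D (E : DTree D -> R) (xs : data D)
    (rs : seq (rule D)) (d : DTree D) : (1 < size rs)%N ->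
  odtBF E xs rs =
  minE E d
    [seq DN (odtBF E (inter (posr r) xs) p.1) r
            (odtBF E (inter (negr r) xs) p.2)
       | r <- rs, p <- splitsBF (rem r rs)].
Proof.
move=> gt1; have minEd a b (l : seq (DTree D)) : (0 < size l)%N -> minE E a l = minE E b l.
  by elim: l => // c [|c' l] IH _ //; rewrite /= in IH *; rewrite IH.
rewrite (minEd d (DL xs)); last first.
  case: rs gt1 => // r rs _.
  by rewrite map_cons size_cat size_map size_splitsBF addn_gt0 expn_gt0.
rewrite -(odtBF_recE E xs (leqnSn _)) odtBF_recS //; congr minE.
apply: (congr1 flatten); apply/eq_in_map => t t_rs; apply/eq_in_map => p p_t.
have [n1 n2] := size_split_rem (leqnSn _) t_rs p_t.
by rewrite !odtBF_recE.
Qed.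

End Objective.

(* Main.v *)
(* Intersecting the data with a region commutes with generation, so the two
   subtrees of a generated node range exactly over the trees generated from the
   two parts of the data.  The rest is dynamic programming: such subtrees are
   fixed by the restriction to their region, so the optimality of the recursive
   solutions is what the monotonicity hypothesis asks for. *)
Require Import Defs.
From HB Require Import structures.
From mathcomp Require Import all_boot all_order all_algebra.
From mathcomp Require Import reals.
Set Implicit Arguments. Unset Strict Implicit. Unset Printing Implicit Defensive.
Import Order.TTheory GRing.Theory Num.Theory.
Local Open Scope ring_scope.

Lemma eq_mapD D (S T : {pred point D}) : S =i T -> mapD S =1 mapD T.
Proof.
move=> eqST; elim=> [ys|u IHu r v IHv] /=; last by rewrite IHu IHv.
by congr DL; apply: eq_filter.
Qed.

Lemma mapD_comp D (S T : {pred point D}) (t : DTree D) :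
  mapD S (mapD T t) = mapD [predI S & T] t.
Proof.
elim: t => [ys|u IHu r v IHv] /=; last by rewrite IHu IHv.
by rewrite /inter -filter_predI.
Qed.

Lemma inter_id D (S : {pred point D}) (ys : data D) :
  {subset ys <= S} -> inter S ys = ys.
Proof. by move=> sub; apply/all_filterP/allP. Qed.

Lemma interC D (S T : {pred point D}) (ys : data D) :
  inter S (inter T ys) = inter T (inter S ys).
Proof. by rewrite /inter -!filter_predI; apply: eq_filter => x; exact: andbC. Qed.

Lemma mem_inter D (S : {pred point D}) (ys : data D) x :
  (x \in inter S ys) = (x \in S) && (x \in ys).
Proof. exact: mem_filter. Qed.

(** Induction along the recursion shared by [genDTBFs] and [odtBF]. It is well founded because
    removing the root rule [r] leaves both parts of a split strictly shorter than [rs]. *)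
Lemma split_ind (T : eqType) (P : seq T -> Prop) :
  P [::] -> (forall r, P [:: r]) ->
  (forall rs, (1 < size rs)%N ->
     (forall r p, r \in rs -> p \in splitsBF (rem r rs) -> P p.1 /\ P p.2) ->
     P rs) ->
  forall rs, P rs.
Proof.
move=> P0 P1 PS rs; have [n] := ubnP (size rs).
elim: n rs => // n IH [|r [|r' rs]] // le_n; apply: PS => // s p s_rs.
move=> /size_splitsBF_mem; rewrite size_rem // => -[le1 le2].
by split; apply: IH; [exact: leq_ltn_trans le1 le_n | exact: leq_ltn_trans le2 le_n].
Qed.

(** Every leaf holds only points of [xs]: at a node, both subtrees have just been cut down to
    sublists of [xs], so cutting by [xs] once more is absorbed. *)
Lemma genDTBFs_mapD_mem D (xs : data D) rs t :
  t \in genDTBFs xs rs -> mapD (mem xs) t = t.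
Proof.
case: rs => [|r [|r' rs]].
- by rewrite genDTBFs0 inE => /eqP-> /=; rewrite inter_id.
- rewrite genDTBFs1 inE => /eqP-> /=.
  by congr (DN (DL _) _ (DL _)); apply: inter_id => x;
    rewrite mem_inter => /andP[].
- rewrite genDTBFsE // => /flatten_mapP[s _] /flatten_mapP[p _].
  case/allpairsP=> -[u v] /= [_ _ ->] /=; rewrite !mapD_comp.
  by congr DN; apply: eq_mapD => x; rewrite !inE !mem_inter;
    case: (x \in xs); rewrite ?andbT ?andbF.
Qed.

Lemma genDTBFs_inter D (S : {pred point D}) (xs : data D) rs :
  genDTBFs (inter S xs) rs = [seq mapD S t | t <- genDTBFs xs rs].
Proof.
elim/split_ind: rs => [|r|rs gt1 IH] //; first by rewrite !genDTBFs1 /= !(interC S).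
rewrite !genDTBFsE // map_flatten -map_comp; congr flatten.
apply/eq_in_map => r r_rs /=; rewrite map_flatten -map_comp; congr flatten.
apply/eq_in_map => p p_r /=; have [-> ->] := IH r p r_rs p_r.
rewrite allpairs_mapl allpairs_mapr map_allpairs.
(* Composed restrictions amount to one restriction to the intersection. On either side it is the
   intersection of [S], the region of [r] and [xs]. *)
apply: eq_allpairs => // u v /=; rewrite !mapD_comp.
by congr DN; apply: eq_mapD => x; rewrite !inE !mem_inter;
  case: (x \in S); rewrite ?andbT ?andbF.
Qed.

(** Leaves generated from [xs] already lie in [xs], so restricting them to the list [inter S xs] has
    the same effect as restricting them to [S]. *)
Lemma mapD_inter_genDTBFs D (S : {pred point D}) (xs : data D) rs :
  [seq mapD (mem (inter S xs)) t | t <- genDTBFs xs rs] =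
  genDTBFs (inter S xs) rs.
Proof.
rewrite genDTBFs_inter; apply/eq_in_map => t /genDTBFs_mapD_mem {2}<-.
by rewrite mapD_comp; apply: eq_mapD => x; rewrite !inE mem_inter.
Qed.

(** Brings the generator to the shape of the recursion of [odtBF], with the data split before the
    recursive calls. *)
Lemma genDTBFs_splitE D (xs : data D) rs : (1 < size rs)%N ->
  genDTBFs xs rs =
  flatten [seq
    flatten [seq
      [seq DN u r v | u <- genDTBFs (inter (posr r) xs) p.1,
                      v <- genDTBFs (inter (negr r) xs) p.2]
      | p <- splitsBF (rem r rs)]
    | r <- rs].
Proof.
move=> gt1; rewrite genDTBFsE //; congr flatten; apply: eq_map => r.
congr flatten; apply: eq_map => p.
by rewrite -!mapD_inter_genDTBFs allpairs_mapl allpairs_mapr.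
Qed.

Lemma mapD_genDTBFs_inter D (S : {pred point D}) (xs : data D) rs t :
  t \in genDTBFs (inter S xs) rs -> mapD S t = t.
Proof.
rewrite genDTBFs_inter => /mapP[u _ ->].
by rewrite mapD_comp; apply: eq_mapD => x; rewrite !inE andbb.
Qed.

Lemma minE_mem (R : realType) (T : eqType) (E : T -> R) d s :
  s != [::] -> minE E d s \in s.
Proof.
elim: s => [|a [|b s] IH] // _; first by rewrite mem_head.
have {IH} := IH isT; rewrite [minE _ _ (a :: _)]/=.
by case: ifP => _ mem_s; rewrite inE ?eqxx // mem_s orbT.
Qed.

Lemma minE_le (R : realType) (T : eqType) (E : T -> R) d s a :
  a \in s -> E (minE E d s) <= E a.
Proof.
elim: s => [|b [|c s] IH] //; first by rewrite inE => /eqP->.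
rewrite inE [minE _ _ (b :: _)]/= => /predU1P[->|/IH le_a].
  by case: ifP => // /negbT; rewrite -ltNge => /ltW.
by case: ifP => // le_b; exact: le_trans le_a.
Qed.

Lemma odtBF_genDTBFs (R : realType) D (E : DTree D -> R) (xs : data D) rs :
  odtBF E xs rs \in genDTBFs xs rs.
Proof.
elim/split_ind: rs xs => [|r|rs gt1 IH] xs; rewrite ?mem_head //.
rewrite genDTBFs_splitE // (odtBFE E xs (DL xs)) //.
set s := (X in minE _ _ X); have: minE E (DL xs) s \in s.
  (* The candidate list is non-empty because the first rule alone contributes a power of two of
     splits. *)
  apply: minE_mem; rewrite {}/s; case: rs gt1 {IH} => // r rs _.
  rewrite -size_eq0 map_cons size_cat size_map size_splitsBF.
  by rewrite addn_eq0 negb_and -lt0n expn_gt0.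
case/allpairsPdep=> r [p] [r_rs p_r ->]; have [IH1 IH2] := IH r p r_rs p_r.
apply/flatten_mapP; exists r => //; apply/flatten_mapP; exists p => //.
exact: allpairs_f.
Qed.

Theorem theorem12 (R : realType) (D K : nat) (rs : seq (rule D)) (xs : data D)
  (f : data D -> R) (g : R * R -> R) (E : DTree D -> R)
  (rs_size : size rs = K) (rs_uniq : uniq rs)
  (E_DL : forall ys : data D, E (DL ys) = f ys)
  (E_DN : forall (u : DTree D) (r : rule D) (v : DTree D),
     E (DN u r v) = g (E (mapD (posr r) u), E (mapD (negr r) v)))
  (g_max : forall a b : R, Num.max a b <= g (a, b))
  (E_mono : forall (r : rule D) (u u' v v' : DTree D),
     E (mapD (posr r) u) <= E (mapD (posr r) u') /\
     E (mapD (negr r) v) <= E (mapD (negr r) v') ->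
     E (DN u r v) <= E (DN u' r v')) :
  odtBF E xs rs \in genDTBFs xs rs /\
  (forall t : DTree D, t \in genDTBFs xs rs -> E (odtBF E xs rs) <= E t).
Proof.
split=> [|t]; first exact: odtBF_genDTBFs.
elim/split_ind: rs xs t {rs_size rs_uniq} => [|r|rs gt1 IH] xs t.
- by rewrite genDTBFs0 inE => /eqP->.
- by rewrite genDTBFs1 inE => /eqP->.
rewrite genDTBFs_splitE // => /flatten_mapP[r r_rs] /flatten_mapP[p p_r].
case/allpairsP=> -[u v] /= [u_gen v_gen ->].
have [IH1 IH2] := IH r p r_rs p_r; rewrite (odtBFE E xs (DL xs)) //.
(* The intermediate tree keeps the root rule and the split of the competitor but uses the recursive
   solutions as subtrees, which makes it one of the candidates minimised over. *)
apply: (@le_trans _ _ (E (DN (odtBF E (inter (posr r) xs) p.1) r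
                              (odtBF E (inter (negr r) xs) p.2)))).
  by apply: minE_le; apply/allpairsPdep; exists r, p.
(* All four subtrees are generated from data on their own side of [r], so [mapD] fixes them and the
   premise of [E_mono] reduces to the two induction hypotheses. *)
apply: E_mono; rewrite !(mapD_genDTBFs_inter (odtBF_genDTBFs _ _ _)).
by rewrite (mapD_genDTBFs_inter u_gen) (mapD_genDTBFs_inter v_gen) IH1 ?IH2.
Qed.
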